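(* No randomized simultaneous protocol for combinatorial auctions with subadditive bidders where each bidder sends sub-exponentially many bits can approximate the social welfare to within a factor of $m^{\frac14-\epsilon}$, for every constant $\epsilon>0$. Here $m$ is the number of items.
   Context: Combinatorial auction: a set $M$ of $m$ items and $n$ bidders; bidder $i$ has a valuation $v_i:2^M\to\mathbb{R}$ that is normalized ($v_i(\emptyset)=0$) and non-decreasing. An allocation $(A_1,\dots,A_n)$ consists of disjoint subsets of $M$; its social welfare is $\sum_i v_i(A_i)$, and $OPT$ is the maximum social welfare. A valuation $v$ is subadditive if $v(S\cup T)\le v(S)+v(T)$ for all bundles $S,T$. In a simultaneous protocol each bidder, simultaneously with the others, sends one message based on his own valuation to a central planner, who outputs an allocation based only on the messages; a randomized protocol may in addition use random bits. A randomized protocol approximates the social welfare to within a factor $c$ if on every input the expected social welfare of its output is at least $OPT/c$. *)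

(* Defs.v *)
From HB Require Import structures.
From mathcomp Require Import all_boot all_order all_algebra.
From mathcomp Require Import all_classical all_reals all_analysis.

Set Implicit Arguments.
Unset Strict Implicit.
Unset Printing Implicit Defensive.

Import Order.TTheory GRing.Theory Num.Theory.

Local Open Scope classical_set_scope.
Local Open Scope ring_scope.

Notation valuation R m := ({ffun {set 'I_m} -> R}).

Section Auctions.
Variables (R : realType) (n m : nat).
Implicit Types (v : valuation R m) (vs : 'I_n -> valuation R m).

Definition normalized v := v finset.set0 = 0.

Definition nondecreasing_valuation v :=
  forall S T : {set 'I_m}, S \subset T -> v S <= v T.

Definition subadditive v :=
  forall S T : {set 'I_m}, v (S :|: T)%SET <= v S + v T.

Definition subadditive_bidder v :=
  [/\ normalized v, nondecreasing_valuation v & subadditive v].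

(* Items may be left unallocated. *)
Definition is_allocation (A : {ffun 'I_n -> {set 'I_m}}) : bool :=
  [forall i, forall j, (i != j) ==> [disjoint A i & A j]].

Definition allocation := {A : {ffun 'I_n -> {set 'I_m}} | is_allocation A}.

Definition welfare vs (A : allocation) : R := \sum_(i < n) vs i (val A i).

(* The default value 0 of the maximum is harmless: for normalized valuations
   it is the welfare of the empty allocation. *)
Definition OPT vs : R := \big[Num.max/0]_(A : allocation) welfare vs A.

End Auctions.

(* [Omega] is the space of random strings. They are visible to the bidders and
   to the planner (public coins); private coins are the special case where
   Omega is a product and each party reads only its own coordinate. *)
Record simultaneous_protocol (R : realType) (n m : nat) (Omega : Type) :=
  SimultaneousProtocol {
    message : Omega -> 'I_n -> valuation R m -> seq bool ;
    planner : Omega -> {ffun 'I_n -> seq bool} -> allocation n m }.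

Definition outcome (R : realType) (n m : nat) (Omega : Type)
    (pi : simultaneous_protocol R n m Omega) (vs : 'I_n -> valuation R m)
    (w : Omega) : allocation n m :=
  planner pi w [ffun i => message pi w i (vs i)].

Definition message_length_at_most (R : realType) (n m : nat) (Omega : Type)
    (pi : simultaneous_protocol R n m Omega) (l : nat) :=
  forall (w : Omega) (i : 'I_n) (v : valuation R m),
    subadditive_bidder v -> (size (message pi w i v) <= l)%N.

Section Randomized.
Variables (R : realType) (n m : nat).
Variables (d : measure_display) (Omega : measurableType d).

(* On every input the outcome is a random variable with values in the finite
   set of allocations, so that expected welfare makes sense. *)
Definition measurable_protocol (pi : simultaneous_protocol R n m Omega) :=
  forall (vs : 'I_n -> valuation R m) (A : allocation n m),
    (forall i, subadditive_bidder (vs i)) ->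
    measurable [set w : Omega | outcome pi vs w = A].

Definition approximates (P : probability Omega R)
    (pi : simultaneous_protocol R n m Omega) (c : R) :=
  forall vs : 'I_n -> valuation R m,
    (forall i, subadditive_bidder (vs i)) ->
    ((OPT vs / c)%:E <= 'E_P[fun w => welfare vs (outcome pi vs w)])%E.

End Randomized.

(* L n m is at most 2 ^ ((n + m) ^ o(1)). *)
Definition subexponential (R : realType) (L : nat -> nat -> nat) :=
  forall delta : R, 0 < delta ->
    exists N : nat, forall n m : nat, (N <= n + m)%N ->
      (L n m)%:R <= 2 `^ ((n + m)%:R `^ delta).

(* Main.v *)
(** Every bidder [i] wants one of [t] bundles, and [v_i S] is the largest number
   of items of [S] in one of them.  The items are arranged in [k] groups of
   chunks of [a] items; a bidder's bundles take one item from each group, and in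
   a group he only uses items of [b + 1] chunks: [b] chunks common to all
   bidders, and the own chunk of his block of bidders.  All bundles are random,
   except that one of them, at a random index, uses the own chunk in every
   group.  Random permutations of the chunks hide which chunks are common.
   The planted bundles of all the bidders are nearly disjoint, so the optimum is
   at least [n k / 2].  On the other hand a planner who knows the permutations
   but not the planted bundles can collect value only from
   - the common items, which are few;
   - the intersections of the other bundles with the own chunks, of size at most
     [ln t + O(1)] since [k = b];
   - the planted bundles.  By the symmetry between own and common chunks, each
     of a bidder's [t] bundles is equally likely to be the planted one, and a
     union bound over the messages with an exponential moment shows that a
     message of [l] bits barely helps when [t > l]: of the items given to a
     bidder he values an expected fraction of at most [3 / a] on this account.
   With [k], [a], [b] of order [s], with [s ^ 2] blocks of [s] bidders and
   [m] of order [s ^ 4], the welfare is [O(s ^ 3 ln t)] while the optimum is of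
   order [s ^ 4], and [ln t] is [m ^ o(1)]. *)
Require Import Defs.
From mathcomp Require Import all_boot all_order all_fingroup all_algebra.
From mathcomp Require Import all_classical all_reals all_analysis.
From mathcomp Require Import measurable_realfun ring lra zify.

Import Order.TTheory GRing.Theory Num.Theory.
Local Open Scope ring_scope.

Set Implicit Arguments.
Unset Strict Implicit.

(** * Uniform averages over finite types and exponential moments *)

Section Average.
Variable R : realType.

Definition avg (T : finType) (f : T -> R) : R := (\sum_x f x) / #|T|%:R.

Lemma eq_avg (T : finType) (f g : T -> R) : f =1 g -> avg f = avg g.
Proof. by move=> fg; rewrite /avg (eq_bigr _ (fun x _ => fg x)). Qed.

Lemma le_avg (T : finType) (f g : T -> R) :
  (forall x, f x <= g x) -> avg f <= avg g.
Proof. by move=> fg; rewrite ler_wpM2r ?invr_ge0// ler_sum. Qed.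

Lemma avg_cst (T : finType) (x : T) (c : R) : avg (fun _ : T => c) = c.
Proof.
have T0 : #|T|%:R != 0 :> R.
  by rewrite pnatr_eq0 -lt0n; apply/card_gt0P; exists x.
by rewrite /avg sumr_const -[c *+ _]mulr_natr mulfK.
Qed.

Lemma avgD (T : finType) (f g : T -> R) :
  avg (fun x => f x + g x) = avg f + avg g.
Proof. by rewrite /avg big_split mulrDl. Qed.

Lemma avgN (T : finType) (f : T -> R) : avg (fun x => - f x) = - avg f.
Proof. by rewrite /avg sumrN mulNr. Qed.

Lemma avgZ (T : finType) (c : R) (f : T -> R) :
  avg (fun x => c * f x) = c * avg f.
Proof. by rewrite /avg -mulr_sumr mulrA. Qed.

Lemma avg_sum (T : finType) (I : Type) (r : seq I) (P : pred I)
    (f : I -> T -> R) :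
  avg (fun x => \sum_(i <- r | P i) f i x) = \sum_(i <- r | P i) avg (f i).
Proof. by rewrite /avg exchange_big/= mulr_suml. Qed.

Lemma avg_pair (S T : finType) (f : S * T -> R) :
  avg f = avg (fun x => avg (fun y => f (x, y))).
Proof.
rewrite /avg card_prod natrM invfM -mulr_suml mulrAC mulrA; congr (_ / _ / _).
by rewrite pair_big/=; apply: eq_bigr => -[].
Qed.

Lemma avg_exchange (S T : finType) (f : S -> T -> R) :
  avg (fun x => avg (f x)) = avg (fun y => avg (f^~ y)).
Proof. by rewrite /avg -!mulr_suml exchange_big/= mulrAC. Qed.

Lemma avg_invol (T : finType) (h : T -> T) (f : T -> R) :
  involutive h -> avg (fun x => f (h x)) = avg f.
Proof.
move=> hK; rewrite /avg [in RHS](reindex h)//.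
by exists h => x _; rewrite hK.
Qed.

(** Jensen's inequality, from the tangent to the exponential at the mean. *)
Lemma expR_avg (T : finType) (x : T) (f : T -> R) :
  expR (avg f) <= avg (fun y => expR (f y)).
Proof.
set u := avg f.
have -> : expR u = avg (fun y => expR u * (1 + (f y - u))).
  rewrite avgZ avgD (avg_cst x) avgD (avg_cst x) -/u.
  by rewrite subrr addr0 mulr1.
apply: le_avg => y; rewrite -[in leRHS](subrK u (f y)) expRD mulrC.
by rewrite ler_wpM2r ?expR_ge0// expR_ge1Dx.
Qed.

Definition upd (I X : finType) (w : {ffun I -> X}) (i : I) (x : X) :
  {ffun I -> X} := [ffun j => if j == i then x else w j].

Lemma updE (I X : finType) (w : {ffun I -> X}) (i : I) (x : X) :
  upd w i x i = x.
Proof. by rewrite ffunE eqxx. Qed.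

(** Resampling a coordinate preserves the uniform distribution: exchanging it with a fresh value is
    an involution of the pairs [(w, x)]. *)
Lemma avg_upd (I X : finType) (i : I) (f : {ffun I -> X} -> R) :
  avg f = avg (fun w => avg (fun x => f (upd w i x))).
Proof.
rewrite -(avg_pair (fun y => f (upd y.1 i y.2))).
pose h (y : {ffun I -> X} * X) := (upd y.1 i y.2, y.1 i).
have hK : involutive h.
  move=> [w x]; rewrite /h /= updE; congr pair.
  by apply/ffunP => j; rewrite !ffunE; case: eqP => [->|].
rewrite (avg_invol (fun y => f y.1) hK) avg_pair /=.
rewrite /avg; congr (_ / _); apply: eq_bigr => w _.
by rewrite -/(avg (fun _ : X => f w)) (avg_cst (w i)).
Qed.

Lemma avg_coord (I X : finType) (w0 : {ffun I -> X}) (i : I) (f : X -> R) :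
  avg (fun w : {ffun I -> X} => f (w i)) = avg f.
Proof.
rewrite (avg_upd i) -[RHS](avg_cst w0); apply: eq_avg => w.
by apply: eq_avg => x; rewrite updE.
Qed.

Lemma avg_prod (I X : finType) (f : I -> X -> R) :
  avg (fun w : {ffun I -> X} => \prod_i f i (w i)) = \prod_i avg (f i).
Proof.
rewrite /avg big_split/= bigA_distr_bigA/=; congr (_ * _).
by rewrite prodr_const card_ffun natrX exprVn.
Qed.

Lemma expR_nat_of_bool (b : bool) : expR b%:R <= 1 + 3 * b%:R :> R.
Proof.
case: b; last by rewrite mulr0 addr0 expR0.
have e2 : expR (2^-1) <= 2 :> R.
  rewrite -[2^-1]opprK expRN -[leRHS]invrK lef_pV2 ?posrE ?expR_gt0//.
  by apply: le_trans (expR_ge1Dx _); lra.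
rewrite (_ : true%:R = 2^-1 + 2^-1 :> R); last by rewrite /=; lra.
by rewrite expRD (le_trans (ler_pM _ _ e2 e2)) ?expR_ge0//; lra.
Qed.

Lemma natr_card (X : finType) (A : {set X}) :
  #|A|%:R = \sum_x (x \in A)%:R :> R.
Proof.
rewrite -sum1_card natr_sum big_mkcond/=.
by apply: eq_bigr => x _; case: (x \in A).
Qed.

(** By independence the moment factors. With [p] the density of [A i], each factor is at most
    [1 + 3 p <= expR (3 p)], because [e <= 4]. *)
Lemma avg_expR_count (I X : finType) (w0 : {ffun I -> X})
    (A : I -> {set X}) :
  avg (fun w : {ffun I -> X} => expR (\sum_i (w i \in A i)%:R)) <=
  expR (3 / #|X|%:R * \sum_i #|A i|%:R).
Proof.
under eq_avg do rewrite expR_sum.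
rewrite (avg_prod (fun i x => expR (x \in A i)%:R)) mulr_sumr expR_sum.
apply: ler_prod => i _; apply/andP; split.
  by rewrite mulr_ge0 ?invr_ge0// sumr_ge0// => x _; rewrite expR_ge0.
apply: le_trans (expR_ge1Dx _).
apply: (@le_trans _ _ (avg (fun x => 1 + 3 * (x \in A i)%:R))).
  by apply: le_avg => x; exact: expR_nat_of_bool.
rewrite avgD (avg_cst (w0 i)) avgZ lerD2l -mulrA ler_wpM2l//.
by rewrite mulrC /avg natr_card.
Qed.

Lemma le_ln_expR (x y : R) : expR x <= y -> x <= ln y.
Proof.
move=> xy; rewrite -[leLHS]expRK ler_ln// posrE ?expR_gt0//.
exact: lt_le_trans (expR_gt0 _) xy.
Qed.

(* By Jensen's inequality it is enough to bound the average of the exponential,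
   which is at most its sum over all possible messages [u], and for a fixed [u]
   the average of the product factors. *)
Lemma avg_message_bound (I X : finType) (M : eqType) (w0 : {ffun I -> X})
    (h : M -> X -> R) (phi : {ffun I -> X} -> M) (r : seq M) :
    (forall w, phi w \in r) ->
    (forall u, avg (fun x => expR (h u x)) <= 1) ->
  avg (fun w : {ffun I -> X} => \sum_i h (phi w) (w i)) <= ln (size r)%:R.
Proof.
move=> phir h1; apply: le_ln_expR; apply: le_trans (expR_avg w0 _) _.
pose F u w := \prod_(i : I) expR (h u (w i)).
apply: (@le_trans _ _ (avg (fun w : {ffun I -> X} => \sum_(u <- r) F u w))).
  apply: le_avg => w; rewrite expR_sum.
  rewrite (big_rem (phi w))//= lerDl sumr_ge0// => u _.
  by rewrite prodr_ge0// => i _; exact: expR_ge0.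
rewrite avg_sum -sum1_size natr_sum; apply: ler_sum => u _.
rewrite /F (avg_prod (fun _ x => expR (h u x))).
apply: Num.Theory.prodr_ile1 => i _.
by rewrite h1 mulr_ge0 ?invr_ge0// sumr_ge0// => x _; rewrite expR_ge0.
Qed.

(** The exponential of a maximum is at most the sum of the exponentials; Jensen turns the resulting
    factor [#|I|] into a logarithm. *)
Lemma avg_max_bound (I X : finType) (w0 : {ffun I -> X}) (i0 : I)
    (f : X -> nat) (y : R) :
    avg (fun x => expR (f x)%:R) <= expR y ->
  avg (fun w : {ffun I -> X} => (\max_i f (w i))%:R) <= ln #|I|%:R + y.
Proof.
move=> fy.
have I0 : 0 < #|I|%:R :> R by rewrite ltr0n; apply/card_gt0P; exists i0.
rewrite -[y]expRK -lnM ?posrE ?expR_gt0//.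
apply: le_ln_expR; apply: le_trans (expR_avg w0 _) _.
apply: (@le_trans _ _
   (avg (fun w : {ffun I -> X} => \sum_i expR (f (w i))%:R))).
  apply: le_avg => w.
  have [i ->] : {i | \max_i f (w i) = f (w i)}.
    by apply: bigop.eq_bigmax; rewrite -(ltr0n R).
  by rewrite (bigD1 i)//= lerDl sumr_ge0// => j _; rewrite expR_ge0.
rewrite avg_sum; under eq_bigr do
  rewrite (avg_coord w0 _ (fun x => expR (f x)%:R)).
rewrite sumr_const -[leLHS]mulr_natl (@eq_card _ _ I)//.
by rewrite ler_wpM2l// ltW.
Qed.

End Average.

Lemma sum_mem_inj (X Y : finType) (f : X -> Y) (S : {set Y}) :
  injective f -> (\sum_x (f x \in S) <= #|S|)%N.
Proof.
move=> f_inj; apply: (@leq_trans #|f @: [set x | f x \in S]|).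
  rewrite card_imset// -sum1_card [leqRHS]big_mkcond leq_sum// => x _.
  by rewrite inE; case: ifP.
by apply/subset_leq_card/fintype.subsetP => _ /imsetP[x + ->]; rewrite inE.
Qed.

(** * Valuations that are maxima of additive ones *)

Section Bundles.
Variables (R : realType) (m k : nat).

Definition overlap (S : {set 'I_m}) (y : {ffun 'I_k -> 'I_m}) : nat :=
  (\sum_g (y g \in S))%N.

Lemma overlapS (S T : {set 'I_m}) y :
  S \subset T -> (overlap S y <= overlap T y)%N.
Proof.
move=> ST; apply: leq_sum => g _.
by case: (boolP (y g \in S)) => // /(fintype.subsetP ST) ->.
Qed.

Lemma overlapU (S T : {set 'I_m}) y :
  (overlap (S :|: T) y <= overlap S y + overlap T y)%N.
Proof.
rewrite -big_split; apply: leq_sum => g _; rewrite inE.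
by case: (y g \in S); case: (y g \in T).
Qed.

Definition xos (t : nat) (Y : {ffun 'I_t -> {ffun 'I_k -> 'I_m}}) :
  valuation R m := [ffun S => (\max_j overlap S (Y j))%N%:R].

Lemma xos_subadditive t (Y : {ffun 'I_t -> {ffun 'I_k -> 'I_m}}) :
  subadditive_bidder (xos Y).
Proof.
split.
- rewrite /normalized ffunE; apply/eqP; rewrite pnatr_eq0 -leqn0.
  apply/bigmax_leqP => j _; rewrite leqn0 /overlap big1// => g _.
  by rewrite finset.in_set0.
- move=> S T ST; rewrite !ffunE ler_nat; apply/bigmax_leqP => j _.
  by apply: leq_trans (overlapS _ ST) _; exact: leq_bigmax.
- move=> S T; rewrite !ffunE -natrD ler_nat; apply/bigmax_leqP => j _.
  apply: leq_trans (overlapU _ _ _) _.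
  by apply: leq_add; exact: leq_bigmax.
Qed.

End Bundles.

(** * Random demands of one bidder and the symmetry hiding the planted bundle *)

Section HardDistribution.
Variables (R : realType) (m t k a N b : nat).

Notation cell := ('I_N + 'I_b)%type.
Notation coords := {ffun 'I_k -> 'I_a}.
Notation label := ({ffun 'I_k -> option 'I_b} * coords)%type.
Notation hiding := {ffun 'I_k -> {perm cell}}.
Notation bundle := {ffun 'I_k -> 'I_m}.
Notation seed := ('I_t * {ffun 'I_t -> label} * coords)%type.

Variable item : 'I_k * cell * 'I_a -> 'I_m.
Hypothesis item_inj : injective item.

(* Cell [inl beta] is the own chunk of block [beta] before hiding, and the cells
   [inr c] are the common ones; a bidder refers to the former as [None]. *)
Definition chunk (beta : 'I_N) (c : option 'I_b) : cell :=
  if c is Some c' then inr c' else inl beta.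

Lemma chunk_inj beta : injective (chunk beta).
Proof. by move=> [c|] [d|]//= [->]. Qed.

Definition place beta (sigma : hiding) (x : label) : bundle :=
  [ffun g => item (g, sigma g (chunk beta (x.1 g)), x.2 g)].

Definition own (z : coords) : label := ([ffun=> None], z).

(* A seed consists of the index of the planted bundle, the labels of all
   bundles (the one at that index is ignored), and the items of the planted
   bundle in the chunks of the block. *)
Definition demands beta sigma (s : seed) : {ffun 'I_t -> bundle} :=
  [ffun j => place beta sigma (upd s.1.2 s.1.1 (own s.2) j)].

(** In each group this swaps the own chunk with the one named by [c]; [rehide] is the same swap
    acting on the permutations. Both are involutions, hence measure-preserving changes of
    variables. *)
Definition relabel (c : {ffun 'I_k -> option 'I_b}) (x : label) : label :=
  ([ffun g => tperm None (c g) (x.1 g)], x.2).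

Definition rehide beta (c : {ffun 'I_k -> option 'I_b}) (sigma : hiding) :
    hiding :=
  [ffun g => (tperm (chunk beta None) (chunk beta (c g)) * sigma g)%g].

Lemma relabelK c : involutive (relabel c).
Proof.
by move=> [d z]; congr pair; apply/ffunP => g; rewrite !ffunE tpermK.
Qed.

Lemma rehideK beta c : involutive (rehide beta c).
Proof.
by move=> sigma; apply/ffunP => g; rewrite !ffunE mulgA tperm2 mul1g.
Qed.

(* A bidder cannot tell a change of the hiding permutation from a change of the
   labels, which is why his own chunk could be any of those he sees. *)
Lemma place_rehide beta c sigma x :
  place beta (rehide beta c sigma) x = place beta sigma (relabel c x).
Proof.
apply/ffunP => g; rewrite !ffunE permM.
by rewrite -(inj_tperm _ _ _ (@chunk_inj beta)).
Qed.

Lemma relabel_own c z : relabel c (own z) = (c, z).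
Proof. by congr pair; apply/ffunP => g; rewrite !ffunE tpermL. Qed.

(** Here [S] does not depend on [z], so group [g] is hit with probability [#|A g| / a]; the sets
    [A g] have total size at most [#|S|] by injectivity of [item]. *)
Lemma avg_own_overlap beta (sigma : hiding) (S : {set 'I_m}) (z0 : coords) :
  avg (fun z : coords => expR ((overlap S (place beta sigma (own z)))%:R -
    3 / a%:R * #|S|%:R)) <= 1 :> R.
Proof.
pose A g := [set x : 'I_a | item (g, sigma g (inl beta), x) \in S].
rewrite (@eq_avg _ _ _ (fun z : coords => expR (- (3 / a%:R * #|S|%:R)) *
    expR (\sum_g (z g \in A g)%:R))); last first.
  move=> z; rewrite -expRD addrC /overlap natr_sum; congr (expR (_ + _)).
  by apply: eq_bigr => g _; rewrite !ffunE inE.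
rewrite avgZ expRN ler_pdivrMl ?expR_gt0// mulr1.
apply: le_trans (avg_expR_count R z0 A) _.
rewrite ler_expR card_ord ler_wpM2l ?divr_ge0// -natr_sum ler_nat.
pose f (gx : 'I_k * 'I_a) := item (gx.1, sigma gx.1 (inl beta), gx.2).
have f_inj : injective f by move=> [g x] [h y] /item_inj[-> _ ->].
apply: leq_trans (sum_mem_inj S f_inj).
rewrite [leqRHS](eq_bigr (fun p => nat_of_bool (f (p.1, p.2) \in S))).
  rewrite -(pair_bigA _ (fun g x => nat_of_bool (f (g, x) \in S)))/=.
  apply: leq_sum => g _.
  by rewrite -sum1_card big_mkcond leq_sum// => x _; rewrite inE; case: ifP.
by move=> [g x].
Qed.

(* [G sigma u] is what the bidder receives when he sends [u]; it may depend on
   [sigma] and, through the messages of the others, on everything but his own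
   seed. *)
Lemma single_bidder beta (G : hiding -> seq bool -> {set 'I_m})
    (phi : {ffun 'I_t -> bundle} -> seq bool) (r : seq (seq bool))
    (s0 : seed) :
    (forall Y, phi Y \in r) ->
  avg (fun y : hiding * seed =>
    let S := G y.1 (phi (demands beta y.1 y.2)) in
    (overlap S (place beta y.1 (own y.2.2)))%:R - 3 / a%:R * #|S|%:R)
  <= ln (size r)%:R / t%:R :> R.
Proof.
move=> phir; rewrite avg_pair/=.
pose f (sigma : hiding) (z : coords) u : R :=
  (overlap (G sigma u) (place beta sigma (own z)))%:R -
    3 / a%:R * #|G sigma u|%:R.
pose plant sigma j (w : {ffun 'I_t -> label}) x :=
  phi [ffun i => place beta sigma (upd w j x i)].
rewrite (@eq_avg _ _ _ (fun sigma => avg (fun j : 'I_t =>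
  avg (fun w : {ffun 'I_t -> label} => avg (fun z : coords =>
    f sigma z (plant sigma j w (own z))))))); last first.
  by move=> sigma; rewrite !avg_pair.
(* Rehiding by [c] while relabelling all of [w] leaves the ignored bundles as they were and turns
   the planted label [own z] into [(c, z)]. *)
have sym (c : {ffun 'I_k -> option 'I_b}) :
  avg (fun sigma => avg (fun j : 'I_t =>
    avg (fun w : {ffun 'I_t -> label} => avg (fun z : coords =>
    f sigma z (plant sigma j w (own z)))))) =
  avg (fun sigma => avg (fun j : 'I_t =>
    avg (fun w : {ffun 'I_t -> label} => avg (fun z : coords =>
    f (rehide beta c sigma) z (plant sigma j w (c, z)))))).
  rewrite -(avg_invol _ (rehideK beta c)); apply: eq_avg => sigma.
  apply: eq_avg => j.
  pose rw (w : {ffun 'I_t -> label}) : {ffun 'I_t -> label} :=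
    [ffun i => relabel c (w i)].
  have rwK : involutive rw.
    by move=> w; apply/ffunP => i; rewrite !ffunE relabelK.
  rewrite -[RHS](avg_invol _ rwK); apply: eq_avg => w; apply: eq_avg => z.
  congr (f _ z (phi _)); apply/ffunP => i; rewrite !ffunE place_rehide.
  by case: ifP => _; rewrite ?relabel_own.
pose h sigma u (x : label) := f (rehide beta x.1 sigma) x.2 u.
(* Averaging over [c] makes the planted label [(c, z)] uniform, so it is just coordinate [j] of a
   uniform [w]. The message no longer depends on [j], and averaging over [j] gives the factor
   [1 / t]. *)
have -> : avg (fun sigma => avg (fun j : 'I_t =>
    avg (fun w : {ffun 'I_t -> label} => avg (fun z : coords =>
    f sigma z (plant sigma j w (own z)))))) =
  avg (fun sigma : hiding => t%:R^-1 * avg (fun w : {ffun 'I_t -> label} =>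
    \sum_j h sigma (phi [ffun i => place beta sigma (w i)]) (w j))).
  rewrite -[LHS](avg_cst ([ffun=> None] : {ffun 'I_k -> option 'I_b})).
  rewrite (eq_avg sym).
  rewrite avg_exchange; apply: eq_avg => sigma.
  rewrite avg_exchange avg_sum mulrC [LHS]/avg card_ord; congr (_ / _).
  apply: eq_bigr => j _.
  rewrite avg_exchange [RHS](avg_upd j); apply: eq_avg => w.
  by rewrite avg_pair; apply: eq_avg => c; apply: eq_avg => z; rewrite updE.
rewrite -[leRHS](avg_cst ([ffun=> 1%g] : hiding)).
apply: le_avg => sigma; rewrite mulrC ler_wpM2r ?invr_ge0//.
apply: (avg_message_bound s0.1.2 (h := h sigma)) => // u.
rewrite avg_pair -[leRHS](avg_cst ([ffun=> None] : {ffun 'I_k -> option 'I_b})).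
apply: le_avg => c; rewrite /h /f /=.
exact: (avg_own_overlap beta (rehide beta c sigma) (G _ u) s0.2).
Qed.

End HardDistribution.

(** * Welfare of a protocol and optimum on the hard instances *)

Section HardInstances.
Variables (R : realType) (m t k a N b n : nat).

Notation cell := ('I_N + 'I_b)%type.
Notation coords := {ffun 'I_k -> 'I_a}.
Notation label := ({ffun 'I_k -> option 'I_b} * coords)%type.
Notation hiding := {ffun 'I_k -> {perm cell}}.
Notation bundle := {ffun 'I_k -> 'I_m}.
Notation seed := ('I_t * {ffun 'I_t -> label} * coords)%type.
Notation instance := (hiding * {ffun 'I_n -> seed})%type.

Variable item : 'I_k * cell * 'I_a -> 'I_m.
Hypothesis item_inj : injective item.
Variable block : 'I_n -> 'I_N.

Definition own_hits (x : label) : nat := (\sum_g (x.1 g == None))%N.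

Definition common_hits (sigma : hiding) (S : {set 'I_m}) : nat :=
  (\sum_g \sum_(c : 'I_b) \sum_x (item (g, sigma g (inr c), x) \in S))%N.

Lemma overlap_place beta sigma (x : label) S :
  (overlap S (place item beta sigma x) <= own_hits x + common_hits sigma S)%N.
Proof.
rewrite -big_split leq_sum// => g _; rewrite !ffunE.
case: (x.1 g) => [c|] /=; last first.
  by apply: leq_trans (leq_addr _ _); case: (_ \in _).
rewrite add0n (bigD1 c)//= (bigD1 (x.2 g))//= -addnA leq_addr//.
Qed.

(** The maximum also runs over the ignored label at the planted index; this keeps it a maximum over
    independent uniform labels. *)
Lemma xos_demands_le beta sigma (s : seed) (S : {set 'I_m}) :
  xos R (demands item beta sigma s) S <=
  (common_hits sigma S)%:R + (\max_j own_hits (s.1.2 j))%N%:R +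
  (overlap S (place item beta sigma (own b s.2)))%:R.
Proof.
rewrite ffunE -!natrD ler_nat; apply/bigmax_leqP => j _.
rewrite !ffunE; case: ifP => _; first exact: leq_addl.
apply: leq_trans (overlap_place _ _ _ _) _; rewrite addnC -addnA leq_add2l.
by apply: leq_trans (leq_addr _ _); exact: leq_bigmax.
Qed.

Lemma avg_own_hits (x0 : label) :
  avg (fun x : label => expR (own_hits x)%:R) <=
  expR (3 / b.+1%:R * k%:R) :> R.
Proof.
rewrite avg_pair/= (@eq_avg _ _ _ (fun c : {ffun 'I_k -> option 'I_b} =>
  expR (\sum_g (c g \in [set None])%:R))); last first.
  move=> c; rewrite /own_hits/= (avg_cst x0.2) natr_sum; congr expR.
  by apply: eq_bigr => g _; rewrite inE.
apply: le_trans (avg_expR_count R x0.1 (fun=> [set None])) _.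
rewrite card_option card_ord; under eq_bigr do rewrite cards1.
by rewrite sumr_const card_ord.
Qed.

Lemma avg_max_own_hits (s0 : seed) :
  avg (fun s : seed => (\max_j own_hits (s.1.2 j))%N%:R) <=
  ln t%:R + 3 / b.+1%:R * k%:R :> R.
Proof.
rewrite avg_pair (@eq_avg _ _ _ (fun x : 'I_t * {ffun 'I_t -> label} =>
  (\max_j own_hits (x.2 j))%N%:R)); last by move=> x /=; rewrite (avg_cst s0.2).
rewrite avg_pair/= (avg_cst s0.1.1).
rewrite -[in leRHS](card_ord t).
apply: (avg_max_bound s0.1.2 s0.1.1); exact: avg_own_hits (s0.1.2 s0.1.1).
Qed.

Lemma allocation_mem (A : allocation n m) (x : 'I_m) :
  (\sum_i (x \in val A i) <= 1)%N.
Proof.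
have [/existsP[i xi]|/existsPn nx] := boolP [exists i, x \in val A i];
  last first.
  by rewrite big1// => i _; rewrite (negbTE (nx i)).
rewrite (bigD1 i)//= xi big1// => j ji.
have /forallP/(_ i)/forallP/(_ j) := valP A.
rewrite eq_sym ji => /= /disjoint_setI0/setP/(_ x).
by rewrite !inE xi => /= ->.
Qed.

Lemma allocation_card (A : allocation n m) : (\sum_i #|val A i| <= m)%N.
Proof.
under eq_bigr do rewrite -sum1_card big_mkcond.
rewrite exchange_big/= -[leqRHS]card_ord -sum1_card leq_sum// => x _.
apply: leq_trans (allocation_mem A x).
by apply: leq_sum => i _; case: ifP.
Qed.

Lemma leq_sum_ord l (F : 'I_l -> nat) c :
  (forall i, F i <= c)%N -> (\sum_i F i <= l * c)%N.
Proof.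
move=> Fc; rewrite -[X in (_ <= X * c)%N](card_ord l) -sum_nat_const.
by apply: leq_sum => i _.
Qed.

Lemma allocation_common_hits sigma (A : allocation n m) :
  (\sum_i common_hits sigma (val A i) <= k * b * a)%N.
Proof.
rewrite exchange_big/= -mulnA; apply: leq_sum_ord => g.
rewrite exchange_big/=; apply: leq_sum_ord => c.
rewrite exchange_big/= -[X in (_ <= X)%N]muln1; apply: leq_sum_ord => x.
exact: allocation_mem.
Qed.

Definition vals (y : instance) (i : 'I_n) : valuation R m :=
  xos R (demands item (block i) y.1 (y.2 i)).

Section Protocol.
Variables (msg : 'I_n -> valuation R m -> seq bool)
  (plan : {ffun 'I_n -> seq bool} -> allocation n m) (r : seq (seq bool)).
Hypothesis msg_r :
  forall i v, subadditive_bidder v -> msg i v \in r.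

Definition out (y : instance) : allocation n m :=
  plan [ffun i => msg i (vals y i)].

(** Once the seeds [rho] of the others are frozen and that of [i] is resampled, the bundle of [i]
    depends only on [sigma] and his message, as [single_bidder] requires. *)
Lemma avg_own_gain (y0 : instance) (i : 'I_n) :
  avg (fun y : instance =>
    (overlap (val (out y) i)
       (place item (block i) y.1 (own b (y.2 i).2)))%:R -
    3 / a%:R * #|val (out y) i|%:R) <= ln (size r)%:R / t%:R :> R.
Proof.
rewrite avg_pair/= avg_exchange (avg_upd i) -[leRHS](avg_cst y0.2).
apply: le_avg => rho; rewrite avg_exchange.
pose G (sigma : hiding) (u : seq bool) : {set 'I_m} :=
  val (plan
    [ffun i' => if i' == i then u else msg i' (vals (sigma, rho) i')]) i.
pose phi (Y : {ffun 'I_t -> bundle}) := msg i (xos R Y).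
have phi_r Y : phi Y \in r by apply: msg_r; exact: xos_subadditive.
apply: le_trans (single_bidder R item_inj (block i) G (y0.2 i) phi_r).
rewrite avg_pair le_eqVlt; apply/orP; left; apply/eqP.
apply: eq_avg => sigma; apply: eq_avg => s /=.
have -> : val (out (sigma, upd rho i s)) i =
    G sigma (phi (demands item (block i) sigma s)).
  congr (fun f => val (plan f) i); apply/ffunP => i'; rewrite !ffunE.
  by case: eqP => [->|i'i]; rewrite /vals /phi /= ?updE// ffunE; case: eqP.
by rewrite updE.
Qed.

(** The four terms account for the common items, the own-chunk items of random bundles, the value of
    planted bundles found blindly, and the advantage due to messages. *)
Lemma welfare_le (y0 : instance) :
  avg (fun y => welfare (vals y) (out y)) <=
  (k * b * a)%:R + n%:R * (ln t%:R + 3 / b.+1%:R * k%:R) +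
  3 / a%:R * m%:R + n%:R * (ln (size r)%:R / t%:R).
Proof.
pose gain i (y : instance) : R :=
  (overlap (val (out y) i) (place item (block i) y.1 (own b (y.2 i).2)))%:R -
  3 / a%:R * #|val (out y) i|%:R.
pose mx i (y : instance) : R := (\max_j own_hits ((y.2 i).1.2 j))%N%:R.
apply: (@le_trans _ _ (avg (fun y : instance => (k * b * a)%:R +
   \sum_i mx i y + 3 / a%:R * m%:R + \sum_i gain i y))).
  apply: le_avg => y.
  have h1 : \sum_i (common_hits y.1 (val (out y) i))%:R <= (k * b * a)%:R :> R.
    by rewrite -natr_sum ler_nat allocation_common_hits.
  have h2 : 3 / a%:R * \sum_i #|val (out y) i|%:R <= 3 / a%:R * m%:R :> R.
    by rewrite ler_wpM2l ?divr_ge0// -natr_sum ler_nat allocation_card.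
  have h3 : welfare (vals y) (out y) <= \sum_i
      ((common_hits y.1 (val (out y) i))%:R + mx i y +
       (3 / a%:R * #|val (out y) i|%:R + gain i y)).
    apply: ler_sum => i _; apply: le_trans (xos_demands_le _ _ _ _) _.
    by rewrite lerD2l /gain addrC subrK.
  apply: le_trans h3 _; rewrite !big_split/= -mulr_sumr addrA.
  by rewrite lerD2r lerD// lerD2r.
rewrite !avgD !(avg_cst y0) !avg_sum !lerD//.
  rewrite mulr_natl -[n in leRHS]card_ord -sumr_const ler_sum// => i _.
  rewrite avg_pair /mx/= (avg_cst y0.1).
  rewrite (avg_coord y0.2 i (fun s : seed => (\max_j own_hits (s.1.2 j))%N%:R)).
  exact: avg_max_own_hits (y0.2 i).
rewrite mulr_natl -[n in leRHS]card_ord -sumr_const ler_sum// => i _.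
exact: avg_own_gain.
Qed.

End Protocol.

Lemma avg_eq_coord (z0 : {ffun 'I_n -> seed}) (i i' : 'I_n) (g : 'I_k) :
  i' != i -> avg (fun z : {ffun 'I_n -> seed} =>
    ((z i').2 g == (z i).2 g)%:R) = a%:R^-1 :> R.
Proof.
move=> i'i; rewrite (avg_upd i') -[RHS](avg_cst z0); apply: eq_avg => z.
rewrite (@eq_avg _ _ _ (fun s : seed => (s.2 g \in [set (z i).2 g])%:R));
  last by move=> s; rewrite updE ffunE [i == i']eq_sym (negbTE i'i) inE.
rewrite avg_pair/= (avg_cst (z i).1).
rewrite (avg_coord (z i).2 g (fun x => (x \in [set (z i).2 g])%:R)).
by rewrite /avg -natr_card cards1 card_ord mul1r.
Qed.

(** Discarding the items contested within the block makes these sets disjoint; across blocks the own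
    chunks already differ. *)
Definition unique_own (y : instance) (i : 'I_n) : {set 'I_m} :=
  [set place item (block i) y.1 (own b (y.2 i).2) g | g : 'I_k &
    [forall i', (i' != i) && (block i' == block i) ==>
       ((y.2 i').2 g != (y.2 i).2 g)]].

Lemma unique_own_allocation (y : instance) :
  is_allocation [ffun i => unique_own y i].
Proof.
apply/forallP => i; apply/forallP => i'; apply/implyP => ii'.
rewrite !ffunE -setI_eq0; apply/eqP/setP => x; rewrite !inE.
apply/negP => /andP[/imsetP[g + ->] /imsetP[g' _]].
rewrite inE !ffunE => /forallP/(_ i') + /item_inj[gg' bb zz].
subst g'; move/perm_inj : bb => [bb].
by rewrite eq_sym ii' bb zz !eqxx.
Qed.

(** Allocate [unique_own]: by a union bound over the block, a planted item is contested with
    probability at most [p / a]. *)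
Lemma avg_OPT_ge (y0 : instance) (p : nat) :
    (forall i, #|[set i' | block i' == block i]| <= p)%N ->
  n%:R * (k%:R * (1 - p%:R / a%:R)) <= avg (fun y => OPT (vals y)).
Proof.
move=> blockp.
pose clash i g i' (y : instance) : R := ((y.2 i').2 g == (y.2 i).2 g)%:R.
pose same i i' := (i' != i) && (block i' == block i).
apply: (@le_trans _ _ (avg (fun y : instance =>
    \sum_i \sum_g (1 - \sum_(i' | same i i') clash i g i' y)))); last first.
  apply: le_avg => y.
  apply: (@le_trans _ _ (welfare (vals y) (Sub _ (unique_own_allocation y))));
    last exact: (le_bigmax _ (fun A => welfare (vals y) A)).
  apply: ler_sum => i _.
  rewrite SubK ffunE [[ffun i0 => unique_own y i0] i]ffunE.
  apply: (@le_trans _ _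
    (overlap (unique_own y i) (place item (block i) y.1 (own b (y.2 i).2)))%:R);
    last first.
    rewrite ler_nat; apply: leq_trans (leq_bigmax (y.2 i).1.1).
    by rewrite ffunE updE.
  rewrite /overlap natr_sum; apply: ler_sum => g _.
  have c0 (P : pred 'I_n) : 0 <= \sum_(i' | P i') clash i g i' y.
    by apply: sumr_ge0 => i' _; exact: ler0n.
  case: (boolP (place item (block i) y.1 (own b (y.2 i).2) g \in _)) => [_|].
    by rewrite gerBl c0.
  (* A lost item has at least one clash, so its term on the left is nonpositive. *)
  move=> /imsetP nu; rewrite subr_le0.
  have /forallPn[i'] : ~~ [forall i', same i i' ==>
       ((y.2 i').2 g != (y.2 i).2 g)].
    by apply/negP => u; apply: nu; exists g; rewrite // inE.
  rewrite negb_imply negbK => /andP[si' e].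
  by rewrite (bigD1 i')//= /clash e lerDl c0.
rewrite avg_sum mulr_natl -[n in leLHS]card_ord -sumr_const ler_sum// => i _.
rewrite avg_sum mulr_natl -[k in leLHS]card_ord -sumr_const ler_sum// => g _.
rewrite avgD avgN (avg_cst y0) lerD2l lerN2 avg_sum.
rewrite (eq_bigr (fun=> a%:R^-1)); last first.
  move=> i' /andP[i'i _]; rewrite avg_pair /clash/= (avg_cst y0.1).
  exact: avg_eq_coord y0.2 _ _ _ i'i.
rewrite sumr_const -[leLHS]mulr_natl ler_wpM2r ?invr_ge0// ler_nat.
apply: leq_trans (blockp i); apply: subset_leq_card.
by apply/fintype.subsetP => i'; rewrite !inE => /andP[].
Qed.

End HardInstances.

(** * From randomized protocols to random inputs *)

Lemma welfare_ge0 (R : realType) (n m : nat) (vs : 'I_n -> valuation R m) A :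
  (forall i, subadditive_bidder (vs i)) -> 0 <= welfare vs A.
Proof.
move=> hvs; apply: sumr_ge0 => i _; have [v0 vmono _] := hvs i.
by rewrite -[leLHS]v0 vmono// finset.sub0set.
Qed.

(** Yao's principle, easy direction: sum the guarantee over the inputs, exchange sum and
    expectation, and bound the integrand for each random string. *)
Lemma approximates_avg (R : realType) (n m : nat) (d : measure_display)
    (Omega : measurableType d) (P : probability Omega R)
    (pi : simultaneous_protocol R n m Omega) (c B : R)
    (I : finType) (y0 : I) (vs : I -> 'I_n -> valuation R m) :
    (forall y i, subadditive_bidder (vs y i)) ->
    measurable_protocol pi -> approximates P pi c ->
    (forall w, avg (fun y => welfare (vs y) (outcome pi (vs y) w)) <= B) ->
  avg (fun y => OPT (vs y)) / c <= B.
Proof.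
move=> hvs mpi apx hB.
have I0 : 0 < #|I|%:R :> R by rewrite ltr0n; apply/card_gt0P; exists y0.
pose X y w : R := welfare (vs y) (outcome pi (vs y) w).
(* [X y] is a finite combination of indicators of the measurable outcome events. *)
have mX y : measurable_fun setT (X y).
  rewrite (_ : X y = fun w => \sum_(A : allocation n m) welfare (vs y) A *
      \1_[set w | outcome pi (vs y) w = A]%classic w).
    apply: measurable_sum => A; apply: measurable_funM => //.
    by apply: measurable_indic; exact: mpi.
  apply/funext => w; rewrite (bigD1 (outcome pi (vs y) w))//= indicE mem_set//.
  rewrite mulr1 big1 ?addr0// => A Aw; rewrite indicE memNset ?mulr0//= => wA.
  by rewrite wA eqxx in Aw.
have EX y : ((OPT (vs y) / c)%:E <= \int[P]_w (X y w)%:E)%E.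
  by have := apx (vs y) (hvs y); rewrite unlock.
rewrite -(ler_pM2l I0) mulrA /avg [#|I|%:R * _]mulrC divfK ?gt_eqF//.
rewrite -lee_fin mulr_suml -sumEFin.
apply: (@le_trans _ _ (\sum_y \int[P]_w (X y w)%:E)%E).
  by apply: lee_sum => y _; exact: EX.
rewrite -ge0_integral_sum//; last 2 first.
- by move=> y; apply/measurable_EFinP.
- by move=> y w _; rewrite lee_fin welfare_ge0.
apply: (@le_trans _ _ (\int[P]_w (cst (#|I|%:R * B)%:E w))%E).
  apply: ge0_le_integral => //.
  - by move=> w _; apply: sume_ge0 => y _; rewrite lee_fin welfare_ge0.
  - by apply: emeasurable_sum => y; apply/measurable_EFinP.
  move=> w _; rewrite sumEFin lee_fin mulrC -ler_pdivrMr//; exact: hB.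
by rewrite integral_cst//= probability_setT mule1.
Qed.

(** * Choice of parameters *)

Lemma short_words (l : nat) : exists2 r : seq (seq bool),
  (size r < 2 ^ l.+1)%N & forall u, (size u <= l)%N -> u \in r.
Proof.
elim: l => [|l [r sr hr]].
  by exists [:: [::]] => // u; rewrite leqn0 => /nilP ->.
exists ([::] :: [seq true :: u | u <- r] ++ [seq false :: u | u <- r]).
  by rewrite /= size_cat !size_map expnS; lia.
move=> [//|x u] su; rewrite inE/= mem_cat.
by case: x su => su; rewrite map_f ?orbT ?hr.
Qed.

(** Take [k = b = s], [a = 2 s], [s ^ 2] blocks of [s] bidders and [t = l + 1]. Then the average
    optimum is at least [n s / 2], while the average welfare is at most [n (ln t + 102)]. *)
Lemma hard_instances (R : realType) (s m l : nat) (d : measure_display)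
    (Omega : measurableType d) (P : probability Omega R)
    (pi : simultaneous_protocol R #|{: 'I_(s ^ 2) * 'I_s}| m Omega) (c : R) :
    (0 < s)%N -> (4 * s ^ 4 <= m <= 64 * s ^ 4)%N -> 0 < c ->
    measurable_protocol pi -> message_length_at_most pi l ->
    approximates P pi c ->
  s%:R <= 2 * c * (ln l.+1%:R + 102).
Proof.
move=> s0 /andP[m_ge m_le] c0 mpi lpi apx.
set n := #|{: 'I_(s ^ 2) * 'I_s}|.
have nE : n = (s ^ 3)%N by rewrite /n card_prod !card_ord -expnSr.
have item_card : (#|{: 'I_s * ('I_(s ^ 2) + 'I_s) * 'I_(2 * s)}| <= m)%N.
  rewrite !card_prod card_sum !card_ord; apply: leq_trans m_ge; nia.
pose item x := widen_ord item_card (enum_rank x).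
have item_inj : injective item.
  by move=> x y /(congr1 val)/= /val_inj/enum_rank_inj.
pose block (i : 'I_n) : 'I_(s ^ 2) := (enum_val i).1.
have block_card i : (#|[set i' | block i' == block i]| <= s)%N.
  pose f (i' : 'I_n) : 'I_s := (enum_val i').2.
  rewrite -[leqRHS]card_ord -(@card_in_imset _ _ f); first exact: max_card.
  move=> i1 i2; rewrite !inE => /eqP b1 /eqP b2 f12; apply: enum_val_inj.
  by apply: injective_projections => //; rewrite -/(block i1) b1 -b2.
have x0 : 'I_(2 * s) by apply: (@Ordinal _ 0); rewrite muln_gt0.
pose z0 : {ffun 'I_s -> 'I_(2 * s)} := [ffun=> x0].
pose y0 : {ffun 'I_s -> {perm ('I_(s ^ 2) + 'I_s)}} * {ffun 'I_n ->
    'I_l.+1 * {ffun 'I_l.+1 -> {ffun 'I_s -> option 'I_s} *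
      {ffun 'I_s -> 'I_(2 * s)}} * {ffun 'I_s -> 'I_(2 * s)}} :=
  ([ffun=> 1%g], [ffun=> (ord0, [ffun=> ([ffun=> None], z0)], z0)]).
have [r sr hr] := short_words l.
pose B : R := (s * s * (2 * s))%N%:R +
  n%:R * (ln l.+1%:R + 3 / s.+1%:R * s%:R) + 3 / (2 * s)%N%:R * m%:R +
  n%:R * (ln (size r)%:R / l.+1%:R).
pose V := @vals R m l.+1 s (2 * s) (s ^ 2) s n item block.
have hV y i : subadditive_bidder (V y i) by exact: xos_subadditive.
have V_B : avg (fun y => OPT (V y)) / c <= B.
  apply: (approximates_avg y0 hV mpi apx) => w.
  have msg_r i v : subadditive_bidder v -> message pi w i v \in r.
    by move=> hv; apply: hr; exact: lpi.
  exact: (welfare_le item_inj block (planner pi w) msg_r y0).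
have sR : 0 < s%:R :> R by rewrite ltr0n.
have nR : n%:R = s%:R ^+ 3 :> R by rewrite nE natrX.
have n0 : 0 < n%:R :> R by rewrite nR exprn_gt0.
have V_ge : n%:R * (s%:R / 2) <= avg (fun y => OPT (V y)).
  apply: le_trans (avg_OPT_ge R item_inj y0 block_card).
  rewrite ler_pM2l// ler_pM2l// natrM invfM mulrCA divff ?gt_eqF//; lra.
(* This fixes [t = l + 1]: there are fewer than [2 ^ (l + 1)] messages, and [2 <= e]. *)
have lnr : ln (size r)%:R / l.+1%:R <= 1 :> R.
  rewrite ler_pdivrMr ?ltr0n// mul1r.
  have [->|r0] := posnP (size r); first by rewrite ln0 ?ler0n.
  rewrite -(@expRK R l.+1%:R) ler_ln ?posrE ?expR_gt0 ?ltr0n//.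
  rewrite (@le_trans _ _ (2 ^+ l.+1))// -?natrX ?ler_nat 1?ltnW//.
  rewrite natrX -[l.+1%:R]mulr1 mulrC expRM_natr lerXn2r ?nnegrE ?expR_ge0//.
  by apply: le_trans (expR_ge1Dx _).
have s1 : 3 / s.+1%:R * s%:R <= 3 :> R.
  by rewrite mulrAC ler_pdivrMr ?ltr0n// ler_pM2l// ler_nat.
have mB : 3 / (2 * s)%N%:R * m%:R <= 96 * n%:R :> R.
  rewrite mulrAC ler_pdivrMr ?ltr0n ?muln_gt0//.
  have : m%:R <= (64 * s ^ 4)%N%:R :> R by rewrite ler_nat.
  rewrite !natrM nR; lra.
have sB : (s * s * (2 * s))%N%:R = 2 * n%:R :> R by rewrite nR !natrM; ring.
(* [102 = 2 + 3 + 96 + 1], one summand for each of [sB], [s1], [mB] and [lnr]. *)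
have B_le : B <= n%:R * (ln l.+1%:R + 102).
  move: s1 mB lnr; rewrite /B sB.
  move: (3 / _ * _) (3 / _ * _) (_ / l.+1%:R) => x y z x3 y96 z1.
  have := ler_wpM2l (ltW n0) x3.
  have := ler_wpM2l (ltW n0) z1.
  lra.
move: (le_trans V_B B_le); rewrite ler_pdivrMr// => /(le_trans V_ge).
rewrite -[X in _ <= X -> _]mulrA ler_pM2l// => sc.
by rewrite mulrAC -mulrA mulrC; lra.
Qed.

(** * Asymptotics in the number of items *)

Lemma fourth_root_bounds (m : nat) :
  exists s : nat, (4 * s ^ 4 <= m < 4 * s.+1 ^ 4)%N.
Proof.
have h0 : exists s, (4 * s ^ 4 <= m)%N by exists 0%N.
have hb s : (4 * s ^ 4 <= m)%N -> (s <= m)%N.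
  by move=> sm; apply: leq_trans sm; case: s => // s; rewrite !expnS; nia.
case: (ex_maxnP h0 hb) => s sm smax; exists s; rewrite sm ltnNge.
by apply/negP => /smax; rewrite ltnn.
Qed.

Section Asymptotics.
Variable R : realType.

Lemma ln_message_length (l : nat) (x : R) :
  0 <= x -> l%:R <= 2 `^ x -> ln l.+1%:R <= 1 + x.
Proof.
move=> x0 lx.
have ln2 : ln 2 <= 1 :> R by apply: (le_ln1Dx (x := 1)); lra.
have px : 1 <= 2 `^ x :> R by rewrite -[leLHS](powRr0 2) ler_powR//; lra.
apply: (@le_trans _ _ (ln (2 * 2 `^ x))).
  by rewrite ler_ln ?posrE ?mulr_gt0 ?powR_gt0// -natr1; lra.
rewrite lnM ?posrE ?powR_gt0// ln_powR.
by have := ler_wpM2l x0 ln2; lra.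
Qed.

Lemma fourth_root_le (m s : nat) :
  (m <= 64 * s ^ 4)%N -> m%:R `^ (1 / 4) <= 3 * s%:R :> R.
Proof.
move=> ms.
have -> : 3 * s%:R = ((3 * s%:R) ^+ 4) `^ (1 / 4) :> R.
  rewrite -powR_mulrn ?mulr_ge0// -powRrM.
  by rewrite (_ : 4 * (1 / 4) = 1) ?powRr1 ?mulr_ge0//; lra.
apply: ge0_ler_powR; rewrite ?nnegrE ?exprn_ge0 ?mulr_ge0//.
(* [64 <= 3 ^ 4]. *)
by rewrite -natrM -natrX ler_nat expnMn; lia.
Qed.

End Asymptotics.

Theorem theorem5p1 (R : realType) (eps : R) (heps : 0 < eps)
    (L : nat -> nat -> nat) (hL : subexponential R L) :
  exists m0 : nat, forall m : nat, (m0 <= m)%N ->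
  exists n : nat,
  forall (d : measure_display) (Omega : measurableType d)
    (P : probability Omega R) (pi : simultaneous_protocol R n m Omega),
    measurable_protocol pi ->
    message_length_at_most pi (L n m) ->
    ~ approximates P pi (m%:R `^ (1 / 4%:R - eps)).
Proof.
(* [delta <= eps / 2] lets half of [eps] absorb the message length; [delta <= 1] gives
   [(2 m) ^ delta <= 2 m ^ delta]. *)
pose delta := Num.min (eps / 2) 1.
have delta0 : 0 < delta by rewrite lt_min; lra.
have delta_eps : delta <= eps / 2 by rewrite ge_min lexx.
have delta1 : delta <= 1 by rewrite ge_min lexx orbT.
have [N hN] := hL delta delta0.
(* Beyond [K], [m ^ (eps / 2)] exceeds [630 = 3 * 210], the product of the constants in
   [fourth_root_le] and [s_le_cu]. *)
have [K hK] : exists K : nat, 630 `^ (2 / eps) < K%:R :> R.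
  exists (Num.bound (630 `^ (2 / eps) : R)).
  exact: archi_boundP (powR_ge0 _ _).
exists (N + 4 + K)%N => m m0m.
have [Nm m4 Km] : [/\ N <= m, 4 <= m & K <= m]%N by split; lia.
have [s /andP[s_le lt_s]] := fourth_root_bounds m.
have s0 : (0 < s)%N by case: s {s_le} lt_s => //; rewrite ltnNge m4.
have m_le : (m <= 64 * s ^ 4)%N.
  have s2 : (s.+1 ^ 4 <= (2 * s) ^ 4)%N by rewrite leq_exp2r//; lia.
  by move: s2; rewrite expnMn; lia.
set n := #|{: 'I_(s ^ 2) * 'I_s}|; exists n.
have n_le : (n <= m)%N.
  rewrite /n card_prod !card_ord -expnSr; apply: leq_trans s_le.
  by apply: (@leq_trans (s ^ 4)); [rewrite leq_pexp2l | rewrite leq_pmull].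
move=> d Omega P pi mpi lpi apx.
pose M : R := m%:R.
have M1 : 1 <= M by rewrite ler1n; exact: leq_trans m4.
have M0 : 0 < M by exact: lt_le_trans M1.
set c := _ `^ _ in apx.
have c0 : 0 < c by rewrite powR_gt0.
have s_le_c : s%:R <= 2 * c * (ln (L n m).+1%:R + 102).
  by apply: (hard_instances s0 _ c0 mpi lpi apx); rewrite s_le m_le.
pose u := M `^ delta.
have u1 : 1 <= u by rewrite -[leLHS](powRr0 M) ler_powR// ltW.
have lnL : ln (L n m).+1%:R <= 1 + 2 * u :> R.
  apply: ln_message_length; first by lra.
  apply: le_trans (hN n m (leq_trans Nm (leq_addl _ _))) _.
  rewrite ler_powR; [by []|lra|].
  apply: (@le_trans _ _ ((2 * M) `^ delta)).
    apply: ge0_ler_powR; rewrite ?nnegrE ?mulr_ge0 ?(ltW M0) ?(ltW delta0)//.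
    by rewrite /M -natrM ler_nat mul2n -addnn leq_add2r.
  rewrite powRM ?(ltW M0)// ler_wpM2r ?powR_ge0//.
  by rewrite -[leRHS]powRr1// ler_powR//; lra.
have cu : c * u <= M `^ (1 / 4 - eps / 2).
  by rewrite -powRD ?(gt_eqF M0) ?implybT// ler_powR//; lra.
(* Since [u >= 1], [2 c (1 + 2 u + 102) <= 210 c u]. *)
have s_le_cu : s%:R <= 210 * (c * u).
  have := ler_wpM2l (ltW c0) lnL; have := ler_wpM2l (ltW c0) u1; lra.
have M_eps : M `^ (eps / 2) <= 630.
  have q0 : 0 < M `^ (1 / 4 - eps / 2) by rewrite powR_gt0.
  rewrite -(ler_pM2l q0) -powRD ?(gt_eqF M0) ?implybT//.
  rewrite subrK.
  by apply: le_trans (fourth_root_le R m_le) _; lra.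
have : 630 `^ (2 / eps) < M by apply: lt_le_trans hK _; rewrite ler_nat.
have e0 : 0 < eps / 2 by lra.
move/(gt0_ltr_powR e0); rewrite -powRrM.
rewrite (_ : 2 / eps * (eps / 2) = 1) ?powRr1; [|lra|by field; lra].
rewrite !nnegrE powR_ge0 (ltW M0) => /(_ isT isT).
by rewrite ltNge M_eps.
Qed.
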